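(* For $n>2$, the restriction of the $\mathbb{R}$-valued Berezin cocycle $c$ on $\mathrm{Sp}(2n,\mathbb{R})$ to the subgroup $\mathrm{Sp}(2n,\mathbb{Z})$ is nontrivial; that is, there is no function $\gamma:\mathrm{Sp}(2n,\mathbb{Z})\to\mathbb{R}$ such that $c(g_1,g_2)=\gamma(g_1)+\gamma(g_2)-\gamma(g_1g_2)$ for all $g_1,g_2\in\mathrm{Sp}(2n,\mathbb{Z})$.
   Context: $\mathrm{Sp}(2n,\mathbb{R})$ is the group of real $2n\times2n$ matrices $g$ with $g^tKg=K$, $K=\begin{pmatrix}0&1\\-1&0\end{pmatrix}$ ($n\times n$ blocks); $\mathrm{Sp}(2n,\mathbb{Z})$ is its subgroup of matrices with integer entries. With $J=\frac1{\sqrt2}\begin{pmatrix}1&i\\i&1\end{pmatrix}$ and $J^{-1}gJ=\begin{pmatrix}\Phi&\Psi\\ \overline\Psi&\overline\Phi\end{pmatrix}$, $\Phi=\Phi(g)$, the Berezin cocycle is $$c(g_1,g_2)=\mathrm{Im}\,\mathrm{tr}\ln\bigl[\Phi(g_1)^{-1}\Phi(g_1g_2)\Phi(g_2)^{-1}\bigr],$$ where the matrix in brackets is $1+Z$ with $\|Z\|<1$ and $\ln(1+Z)=\sum_{k\ge1}(-1)^{k+1}Z^k/k$. *)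

(* Defs.v *)
From HB Require Import structures.
From mathcomp Require Export all_boot all_order all_algebra.
From mathcomp Require Export complex.
From mathcomp Require Export all_classical all_reals all_analysis.
Export Order.TTheory GRing.Theory Num.Theory numFieldNormedType.Exports.

Set Implicit Arguments.
Unset Strict Implicit.
Unset Printing Implicit Defensive.

Local Open Scope classical_set_scope.
Local Open Scope ring_scope.
Local Open Scope complex_scope.

(* The logarithm is centred at the identity: ln_mx A is the series of ln (1 + Z)
   with Z = A - 1.  The limit is taken in the normed topology of 'M[K]_n (max
   norm of the entries) and the operator limn is total: the value is meaningful
   when the series converges, in particular over R[i] when Z has operator norm
   < 1. *)
Definition ln_mx (K : numFieldType) (n : nat) (A : 'M[K]_n) : 'M[K]_n :=
  limn (series (fun k : nat =>
    ((-1) ^+ k / k.+1%:R) *: (A - 1%:M) ^+ k.+1)).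

Section BerezinCocycle.
Variables (R : realType) (n : nat).

Definition Kmx : 'M[R]_(n + n) := block_mx 0 1%:M (- 1%:M) 0.

Definition SpR : set 'M[R]_(n + n) := [set g | g^T *m Kmx *m g = Kmx].

Definition SpZ : set 'M[R]_(n + n) :=
  [set g | SpR g /\ (forall i j, g i j \is a Num.int)].

Definition Jmx : 'M[R[i]]_(n + n) :=
  ((Num.sqrt (2 : R))^-1)%:C *: block_mx 1%:M 'i%:M 'i%:M 1%:M.

Definition Phi (g : 'M[R]_(n + n)) : 'M[R[i]]_n :=
  ulsubmx (invmx Jmx *m map_mx (real_complex R) g *m Jmx).

(* For g1, g2 in SpR the matrices Phi g1 and Phi g2 are invertible and
   the argument of ln_mx is 1 + Z with Z of operator norm < 1, so that neither
   invmx nor the limit takes a default value there. *)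
Definition berezin (g1 g2 : 'M[R]_(n + n)) : R :=
  complex.Im (\tr (ln_mx
    (invmx (Phi g1) *m Phi (g1 *m g2) *m invmx (Phi g2)))).

End BerezinCocycle.

(* Main.v *)
(** Write e(t) = exp(it) and let phase(g) = det Phi(g) / |det Phi(g)|.  Since
    Phi(g1)^-1 Phi(g1 g2) Phi(g2)^-1 = 1 + Z with Z a strict contraction,
    e(Im tr ln (1 + Z)) is the phase of det (1 + Z), that is
    phase(g1 g2) = e(c(g1, g2)) phase(g1) phase(g2).  Hence, if c is the
    coboundary of gamma on Sp(2n, Z), then chi(g) = e(gamma(g)) phase(g) is a
    homomorphism from Sp(2n, Z) to the circle.  Let N(S) be the block matrix
    [[1, S], [0, 1]].  Conjugating N(e0 e0^T) by Levi elements gives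
    N((e0 + e1)(e0 + e1)^T) and N((e0 - e1)(e0 - e1)^T), whose product is
    N(2 e0 e0^T + 2 e1 e1^T); therefore chi(N(e1 e1^T))^2 = 1.  The product
    N(P) N'(-P) N(P), where P = e1 e1^T and N'(-P) = K N(P) K^-1, is a quarter
    turn whose square is F = diag(Q, Q), with Q = 1 - 2 P a reflection, so that
    chi(F) = chi(N(P))^6 = 1.  But c(F, F) = c(1, 1) = 0 forces gamma(F) = 0,
    and phase(F) = det Q = -1, a contradiction. *)
From mathcomp Require Import ring lra.
Require Import Defs.

Import ComplexField.Normc.

Set Implicit Arguments.
Unset Strict Implicit.
Unset Printing Implicit Defensive.

Local Open Scope classical_set_scope.
Local Open Scope ring_scope.
Local Open Scope complex_scope.
Local Open Scope sesquilinear_scope.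

(** * The scalar logarithm *)

Lemma normc_ge_Im (R : rcfType) (z : R[i]) : `|complex.Im z| <= normc z.
Proof. by case: z => a b; rewrite -sqrtr_sqr ler_wsqrtr// lerDr sqr_ge0. Qed.

Lemma normc_ge_Re (R : rcfType) (z : R[i]) : `|complex.Re z| <= normc z.
Proof. by case: z => a b; rewrite -sqrtr_sqr ler_wsqrtr// lerDl sqr_ge0. Qed.

Lemma normcX (R : rcfType) (z : R[i]) k : normc (z ^+ k) = normc z ^+ k.
Proof. by elim: k => [|k IH]; rewrite ?normc1// !exprS normcM IH. Qed.

Lemma normc_real (R : rcfType) (x : R) : normc x%:C = `|x|.
Proof. by rewrite /= expr0n addr0 sqrtr_sqr. Qed.

Lemma normc_ge0 (R : rcfType) (z : R[i]) : 0 <= normc z.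
Proof. by case: z => a b; exact: sqrtr_ge0. Qed.

Lemma ImD (R : pzRingType) (x y : R[i]) :
  complex.Im (x + y) = complex.Im x + complex.Im y.
Proof. by case: x y => a b []. Qed.

Lemma Im_sum (R : pzRingType) (I : Type) (r : seq I) (P : pred I)
    (F : I -> R[i]) :
  complex.Im (\sum_(i <- r | P i) F i) = \sum_(i <- r | P i) complex.Im (F i).
Proof. by elim/big_rec2: _ => // i y1 y2 _ <-; rewrite ImD. Qed.

Lemma ImM_real (R : rcfType) (x : R) (z : R[i]) :
  complex.Im (z * x%:C) = complex.Im z * x.
Proof. by case: z => a b /=; rewrite mulr0 add0r. Qed.

Section expi.
Variable R : realType.
Implicit Types (s t : R).

Definition expi t : R[i] := cos t +i* sin t.

Lemma expi0 : expi 0 = 1.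
Proof. by rewrite /expi cos0 sin0. Qed.

Lemma expiD s t : expi (s + t) = expi s * expi t.
Proof.
rewrite /expi cosD sinD; apply/eqP; rewrite eq_complex /=; apply/andP; split => //.
by rewrite addrC.
Qed.

Lemma expiNK t : expi (- t) * expi t = 1.
Proof. by rewrite -expiD addNr expi0. Qed.

Lemma expi_sum (I : Type) (r : seq I) (F : I -> R) :
  expi (\sum_(i <- r) F i) = \prod_(i <- r) expi (F i).
Proof. by elim/big_rec2: _ => [|i y1 y2 _ <-]; rewrite ?expi0 ?expiD. Qed.

(** In the right half-plane the principal argument is [atan (b / a)]; this fixes the branch of the
    logarithm. *)
Lemma expi_atan (a b : R) : 0 < a ->
  expi (atan (b / a)) * (normc (a +i* b))%:C = a +i* b.
Proof.
move=> a0; have cne : cos (atan (b / a)) != 0.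
  by rewrite cos_atan invr_eq0 sqrtr_eq0 -ltNge ltr_pwDl// sqr_ge0.
have -> : normc (a +i* b) = a * Num.sqrt (1 + (b / a) ^+ 2).
  have ea : a = Num.sqrt (a ^+ 2) by rewrite sqrtr_sqr gtr0_norm.
  rewrite /= [X in _ = X * _]ea -sqrtrM ?sqr_ge0//; congr Num.sqrt; field; exact: lt0r_neq0.
have h : sin (atan (b / a)) = b / a * cos (atan (b / a)).
  by rewrite -{2}(atanK (b / a)) /tan divfK.
rewrite /expi h cos_atan; apply/eqP; rewrite eq_complex /= !mulr0 add0r subr0.
set s := Num.sqrt _; have s0 : s != 0.
  by rewrite sqrtr_eq0 -ltNge ltr_pwDl// sqr_ge0.
by apply/andP; split; apply/eqP; field; rewrite ?s0 ?lt0r_neq0.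
Qed.
End expi.
Lemma geom_sum_div (F : fieldType) (w : F) N : 1 - w != 0 ->
  \sum_(k < N) w ^+ k = (1 - w ^+ N) / (1 - w).
Proof.
move=> w1; apply: (mulIf w1); rewrite divfK//.
by rewrite -[RHS]opprB subrX1 -mulNr opprB mulrC.
Qed.

(** With z = a + ib, the function is the argument of 1 + tz, that is Im ln (1 + tz), and the
    derivative of ln (1 + tz) in t is z / (1 + tz). *)
Lemma is_derive_atan_ratio (R : realType) (a b t : R) : 0 < 1 + t * a ->
  is_derive t 1 (fun x => atan (x * b / (1 + x * a)))
    (complex.Im ((a +i* b) / (1 + t%:C * (a +i* b)))).
Proof.
move=> h; have h0 : 1 + t * a != 0 by exact: lt0r_neq0.
have q0 : (1 + t * a) ^+ 2 + (t * b) ^+ 2 != 0.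
  by rewrite lt0r_neq0// ltr_pwDl ?sqr_ge0// exprn_gt0.
pose f x := x * b / (1 + x * a).
have df : is_derive t 1 f (b / (1 + t * a) ^+ 2).
  rewrite /f; apply: is_derive_eq.
  rewrite /GRing.scale /=; field => //.
have -> : complex.Im ((a +i* b) / (1 + t%:C * (a +i* b))) =
    (1 + (f t) ^+ 2)^-1 * (b / (1 + t * a) ^+ 2).
  rewrite /f /= !mul0r !(subr0, addr0, add0r).
  by field; rewrite h0 q0 /=.
exact: (is_derive1_comp (is_derive1_atan (f t)) df).
Qed.
Definition ln1p_partial (R : rcfType) (z : R[i]) N : R[i] :=
  \sum_(k < N) (-1) ^+ k / k.+1%:R * z ^+ k.+1.

(* Mean value theorem on [0, 1] for t |-> Im (partial sum at t z) minus
   atan (t b / (1 + t a)): the derivatives differ by the tail of a geometric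
   series. *)
Lemma Im_ln1p_partial_atan (R : realType) (a b rho : R) N :
  normc (a +i* b) <= rho -> rho < 1 ->
  `|complex.Im (ln1p_partial (a +i* b) N) - atan (b / (1 + a))|
    <= rho ^+ N / (1 - rho).
Proof.
move=> zr r1; set z := a +i* b.
have r0 : 0 <= rho by apply: le_trans zr; exact: normc_ge0.
have ra : `|a| <= rho by apply: le_trans zr; exact: (normc_ge_Re z).
have den (t : R) : 0 <= t <= 1 -> 1 - rho <= 1 + t * a.
  move=> /andP[t0 t1]; rewrite lerD2l lerNl -mulrN.
  have := ler_norm (- a); rewrite normrN => h.
  by apply: le_trans (_ : t * rho <= _); [rewrite ler_wpM2l// (le_trans h)|rewrite ler_piMl].
(* A real polynomial in t whose value is the imaginary part of the partial sum at tz, so that it can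
   be differentiated formally. *)
pose p : {poly R} :=
  \sum_(k < N) (complex.Im ((-1) ^+ k * z ^+ k.+1) / k.+1%:R) *: 'X^(k.+1).
have p1 : p.[1] = complex.Im (ln1p_partial z N).
  rewrite /p horner_sum Im_sum; apply: eq_bigr => k _.
  rewrite hornerZ hornerXn expr1n mulr1 mulrAC.
  have -> : (k.+1%:R^-1 : R[i]) = ((k.+1%:R^-1 : R)%:C) by rewrite fmorphV rmorph_nat.
  by rewrite ImM_real.
have p0 : p.[0] = 0.
  by rewrite /p horner_sum big1// => k _; rewrite hornerZ hornerXn expr0n mulr0.
have den0 (t : R) : 0 <= t <= 1 -> 1 + t%:C * z != 0.
  move=> t01; rewrite /z eq_complex /= negb_and mul0r subr0.
  by rewrite lt0r_neq0// (lt_le_trans _ (den _ t01))// subr_gt0.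
(* The derivative of the partial sum is z times a geometric sum, so it differs from z / (1 + tz) by
   a single quotient. *)
have dp (t : R) : 0 <= t <= 1 ->
    p^`().[t] - complex.Im (z / (1 + t%:C * z)) =
    - complex.Im (z * (- (t%:C * z)) ^+ N / (1 + t%:C * z)).
  move=> t01; have -> : p^`().[t] =
      complex.Im (z * \sum_(k < N) (- (t%:C * z)) ^+ k).
    rewrite /p raddf_sum /= horner_sum mulr_sumr Im_sum; apply: eq_bigr => k _.
    rewrite derivZ derivXn /= hornerZ hornerMn hornerXn.
    set q := complex.Im _; have -> : q / k.+1%:R * (t ^+ k *+ k.+1) = q * t ^+ k.
      by rewrite -(mulr_natl (t ^+ k)) mulrA divfK ?pnatr_eq0.
    rewrite {}/q.
    rewrite -ImM_real; congr complex.Im.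
    have -> : - (t%:C * z) = -1 * t%:C * z by ring.
    by rewrite rmorphXn /= !exprMn exprS; ring.
  rewrite geom_sum_div ?opprK ?den0// -/(t%:C).
  set w := (- _) ^+ N; set D := 1 + t%:C * z.
  have {1}-> : z / D = z * ((1 - w) / D) + z * w / D by ring.
  by rewrite ImD opprD addrA subrr add0r.
have [] := @MVT R (fun t => p.[t] - atan (t * b / (1 + t * a)))
   (fun t => - complex.Im (z * (- (t%:C * z)) ^+ N / (1 + t%:C * z))) 0 1 ltr01.
- move=> t; rewrite in_itv /= => /andP[t0 t1].
  have t01 : 0 <= t <= 1 by rewrite !ltW.
  rewrite -dp//; apply: is_deriveB; apply: is_derive_atan_ratio.
  by rewrite (lt_le_trans _ (den _ t01))// subr_gt0.
- apply: derivable_within_continuous => t; rewrite in_itv /= => t01.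
  apply: derivableB; first exact: derivable_horner.
  have [] := @is_derive_atan_ratio R a b t => //.
  by rewrite (lt_le_trans _ (den _ t01))// subr_gt0.
move=> c; rewrite in_itv /= => /andP[c0 c1].
rewrite !mul1r !mul0r atan0 p0 !subr0 mulr1 p1 => ->.
have c01 : 0 <= c <= 1 by rewrite !ltW.
rewrite normrN; apply: le_trans (normc_ge_Im _) _.
have Dr : 1 - rho <= normc (1 + c%:C * z).
  apply: le_trans (den _ c01) _; apply: le_trans (ler_norm _) _.
  by rewrite /z /= !mul0r subr0 add0r addr0 -sqrtr_sqr ler_wsqrtr// lerDl sqr_ge0.
have cz : normc (- (c%:C * z)) <= rho.
  rewrite normcN normcM normc_real (ger0_norm (ltW c0)).
  by apply: le_trans zr; rewrite ler_piMl// ?normc_ge0// ltW.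
(* The factor |z| is bounded by 1, the power by rho^N, and the denominator from below by 1 - rho. *)
rewrite !normcM normcV normcX ler_pM ?invr_ge0 ?mulr_ge0 ?exprn_ge0 ?normc_ge0//.
  rewrite -[leRHS]mul1r ler_pM ?exprn_ge0 ?normc_ge0//.
    by rewrite ltW// (le_lt_trans zr).
  by rewrite lerXn2r// nnegrE normc_ge0.
by rewrite lef_pV2 ?posrE// ?subr_gt0// (lt_le_trans _ Dr)// subr_gt0.
Qed.

(** * Strict contractions and the matrix logarithm *)

Section contraction.
Variable C : numClosedFieldType.

(** The constant bounds the square of the operator norm of M acting on rows from the right; squares
    keep the estimates inside the inner product [dotmx]. *)
Definition contracts (c : C) m n (M : 'M[C]_(m, n)) :=
  forall x : 'rV_m, dotmx (x *m M) (x *m M) <= c * dotmx x x.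

Lemma contractsM c d m n p (M : 'M[C]_(m, n)) (N : 'M[C]_(n, p)) : 0 <= d ->
  contracts c M -> contracts d N -> contracts (c * d) (M *m N).
Proof.
move=> d0 hM hN x; rewrite mulmxA; apply: le_trans (hN _) _.
by rewrite [c * d]mulrC -mulrA ler_wpM2l.
Qed.

Lemma contracts1 n : contracts 1 (1%:M : 'M[C]_n).
Proof. by move=> x; rewrite mulmx1 mul1r. Qed.

Lemma contractsX c n (M : 'M[C]_n) k : 0 <= c ->
  contracts c M -> contracts (c ^+ k) (M ^+ k).
Proof.
move=> c0 hM; elim: k => [|k IH]; first exact: contracts1.
by rewrite !exprS; apply: contractsM; rewrite ?exprn_ge0.
Qed.

Lemma dotmx_sum_norm n (x : 'rV[C]_n) : dotmx x x = \sum_j `|x 0 j| ^+ 2.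
Proof.
by rewrite dotmxE mxE; apply: eq_bigr => j _; rewrite !mxE normCK.
Qed.

Lemma contracts_entry c m n (M : 'M[C]_(m, n)) i j :
  contracts c M -> `|M i j| ^+ 2 <= c.
Proof.
move=> /(_ (delta_mx 0 i)); rewrite -rowE !dotmx_sum_norm => h.
have e : \sum_k `|(delta_mx 0 i : 'rV[C]_m) 0 k| ^+ 2 = 1.
  rewrite (bigD1 i)//= big1 ?addr0 ?mxE ?eqxx ?normr1 ?expr1n// => k ki.
  by rewrite mxE eqxx (negPf ki) normr0 expr0n.
rewrite e mulr1 in h; apply: le_trans h.
by rewrite (bigD1 j)//= mxE lerDl sumr_ge0// => k _; rewrite exprn_ge0.
Qed.

Lemma contracts_eigenvalue c n (M : 'M[C]_n) a :
  contracts c M -> eigenvalue M a -> `|a| ^+ 2 <= c.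
Proof.
move=> hM /eigenvalueP [v vM v0]; have := hM v; rewrite vM dnormZ.
by rewrite ler_pM2r// dnorm_gt0.
Qed.
End contraction.

(** * Triangular matrices and the Schur form *)

Section triangular.
Variable F : fieldType.

Lemma trig_mulmx n (A B : 'M[F]_n) : is_trig_mx A -> is_trig_mx B ->
  is_trig_mx (A *m B) /\ forall i, (A *m B) i i = A i i * B i i.
Proof.
move=> /is_trig_mxP hA /is_trig_mxP hB; split=> [|i].
  apply/is_trig_mxP => i j ij; rewrite mxE big1// => k _.
  have [ik|ki] := ltnP i k; first by rewrite hA ?mul0r.
  by rewrite hB ?mulr0// (leq_ltn_trans ki).
rewrite mxE (bigD1 i)//= big1 ?addr0// => k ki.
have [ik|ik] := ltnP i k; first by rewrite hA ?mul0r.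
by rewrite hB ?mulr0// ltn_neqAle ik andbT.
Qed.

Lemma trig_expmx n (A : 'M[F]_n) k : is_trig_mx A ->
  is_trig_mx (A ^+ k) /\ forall i, (A ^+ k) i i = A i i ^+ k.
Proof.
move=> hA; elim: k => [|k [IH1 IH2]].
  split=> [|i]; last by rewrite !expr0 mxE eqxx.
  by apply/is_trig_mxP => i j ij; rewrite mxE; case: eqP ij => // ->; rewrite ltnn.
have [h1 h2] := trig_mulmx hA IH1; split; first by rewrite exprS.
by move=> i; rewrite exprS [A i i ^+ _]exprS -IH2; exact: h2.
Qed.

Lemma trig_eigenvalue n (A : 'M[F]_n) i : is_trig_mx A -> eigenvalue A (A i i).
Proof.
move=> hA; rewrite eigenvalue_root_char char_poly_trig//.
rewrite -(big_map (fun i => A i i) xpredT (fun a => 'X - a%:P)) root_prod_XsubC.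
by apply/mapP; exists i => //; rewrite mem_index_enum.
Qed.

Lemma mxtrace_conj n (P M : 'M[F]_n) : P \in unitmx ->
  \tr (P *m M *m invmx P) = \tr M.
Proof. by move=> Pu; rewrite mxtrace_mulC mulmxA mulVmx// mul1mx. Qed.

Lemma expmx_conj n (P M : 'M[F]_n) k : P \in unitmx ->
  P *m (M ^+ k) *m invmx P = (P *m M *m invmx P) ^+ k.
Proof.
move=> Pu; elim: k => [|k IH]; first by rewrite !expr0 mulmx1 mulmxV.
by rewrite !exprS -IH -!mulmxE !mulmxA mulmxKV.
Qed.
End triangular.

(** Only the diagonal of a Schur form is retained: it gives the traces for the logarithm series and
    the determinant for its exponential. *)
Lemma trigonalization (C : numClosedFieldType) n (M : 'M[C]_n) :
  exists T : 'M[C]_n,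
   [/\ forall i, eigenvalue M (T i i),
       forall k, \tr (M ^+ k) = \sum_i T i i ^+ k &
       \det (1%:M + M) = \prod_i (1 + T i i)].
Proof.
(* [Schur] asks for a positive size, so the empty matrix is treated apart. *)
have [n0|n0] := posnP n.
  subst n; exists 0; split=> [[]//|k|]; rewrite ?big_ord0 ?det_mx00//.
  by rewrite /mxtrace big_ord0.
have [P Pun hT] := Schur M n0; have Pu := unitarymx_unit Pun.
rewrite /similar_to conjumx// in hT.
set T := P *m M *m invmx P in hT; exists T; split=> [i|k|].
- have /eigenvalueP [v vT v0] := trig_eigenvalue i hT.
  apply/eigenvalueP; exists (v *m P).
    by rewrite scalemxAl -vT /T !mulmxA mulmxKV.
  by apply: contra v0 => /eqP e; rewrite -(mulmxK Pu v) e mul0mx.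
- rewrite -(mxtrace_conj _ Pu) expmx_conj// -/T; apply: eq_bigr => i _.
  by have [_ ->] := trig_expmx k hT.
- have -> : 1%:M + M = invmx P *m (1%:M + T) *m P.
    rewrite mulmxDr mulmxDl mulmx1 mulVmx// /T !mulmxA mulVmx// mul1mx.
    by rewrite mulmxKV.
  rewrite !det_mulmx mulrAC -det_mulmx mulVmx// det1 mul1r.
  clearbody T; rewrite det_trig; first by apply: eq_bigr => i _; rewrite !mxE eqxx.
  move/is_trig_mxP: hT => hT; apply/is_trig_mxP => i j ij.
  by rewrite !mxE hT// addr0; case: eqP ij => // ->; rewrite ltnn.
Qed.

(** * Convergence of complex and matrix series *)

Lemma cvg_mx (K : numFieldType) m n (u : nat -> 'M[K]_(m, n)) (S : 'M[K]_(m, n)) :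
  (forall i j, (fun N => u N i j) @ \oo --> S i j) -> u @ \oo --> S.
Proof.
move=> h; apply/cvg_ballP => e e0.
have : \forall N \near \oo, forall i j, ball (S i j) e (u N i j).
  apply: filter_forall => i; apply: filter_forall => j.
  exact: (cvg_ball (h i j)).
by apply: filterS => N hN; split.
Qed.

Section complex_limits.
Variable R : realType.
Local Notation Cplx := (R[i] : numFieldType).

Lemma cvg_complex (u : nat -> Cplx) (l : Cplx) :
  (fun N => complex.Re (u N)) @ \oo --> complex.Re l ->
  (fun N => complex.Im (u N)) @ \oo --> complex.Im l -> u @ \oo --> l.
Proof.
move=> hr hi; apply/cvgrPdist_lt => -[e e'].
(* A positive radius in [R[i]] is real; half of it for each coordinate suffices, since 2 (e/2)^2 <
   e^2. *)
rewrite ltcE /= => /andP[/eqP-> e0]; have e20 : 0 < e / 2 by rewrite divr_gt0.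
have /cvgrPdist_lt/(_ _ e20) H1 := hr.
have /cvgrPdist_lt/(_ _ e20) H2 := hi.
apply: filterS2 H1 H2 => N h1 h2.
rewrite normc_def ltcE /= eqxx /= -[ltRHS]gtr0_norm// -sqrtr_sqr ltr_sqrt ?exprn_gt0//.
move: h1 h2; case: (l) (u N) => a b [c d] /=.
set x := a - c; set y := b - d; rewrite -(real_normK (num_real x)) -(real_normK (num_real y)).
have := normr_ge0 x; have := normr_ge0 y; nra.
Qed.

Lemma Re_series (v : nat -> Cplx) N :
  complex.Re (series v N) = series (fun k => complex.Re (v k)) N.
Proof.
rewrite /series /=; elim/big_rec2: _ => // k x y _ <-.
by case: (v k) y => a b [].
Qed.

(** Each coordinate is compared with a geometric series. The limit of the imaginary parts is
    recorded as well, because the cocycle is an imaginary part. *)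
Lemma is_cvg_complex_series (v : nat -> Cplx) (rho : R) :
  0 <= rho < 1 -> (forall k, normc (v k) <= rho ^+ k) ->
  exists l : Cplx, series v @ \oo --> l /\
    (fun N => complex.Im (series v N)) @ \oo --> complex.Im l.
Proof.
move=> /andP[r0 r1] hv.
have cv (w : nat -> R) : (forall k, `|w k| <= rho ^+ k) -> cvgn (series w).
  move=> hw; apply: normed_cvg; apply: (@series_le_cvg _ _ (geometric 1 rho)).
  - by move=> k /=.
  - by move=> k; rewrite /= mul1r exprn_ge0.
  - by move=> k; rewrite /= mul1r hw.
  by apply: is_cvg_geometric_series; rewrite ger0_norm.
have hr : cvgn (series (fun k => complex.Re (v k))).
  by apply: cv => k; apply: le_trans (hv k); exact: normc_ge_Re.
have hi : cvgn (series (fun k => complex.Im (v k))).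
  by apply: cv => k; apply: le_trans (hv k); exact: normc_ge_Im.
exists (limn (series (fun k => complex.Re (v k))) +i*
        limn (series (fun k => complex.Im (v k)))).
have hi' : (fun N => complex.Im (series v N)) @ \oo -->
    limn (series (fun k => complex.Im (v k))).
  by under eq_fun do rewrite [series v _]/series /= Im_sum; exact: hi.
split=> //; apply: cvg_complex => //=.
by under eq_fun do rewrite Re_series; exact: hr.
Qed.

End complex_limits.

Lemma cvg_bigsum (R : realType) (I : Type) (r : seq I) (f : I -> nat -> R)
    (a : I -> R) :
  (forall i, f i @ \oo --> a i) ->
  (fun N => \sum_(i <- r) f i N) @ \oo --> \sum_(i <- r) a i.
Proof.
move=> h; elim: r => [|i r IH].
  by under eq_fun do rewrite big_nil; rewrite big_nil; exact: cvg_cst.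
by under eq_fun do rewrite big_cons; rewrite big_cons; exact: cvgD.
Qed.

Lemma cvg_Im_ln1p_partial (R : realType) (z : R[i]) : normc z < 1 ->
  (fun N => complex.Im (ln1p_partial z N)) @ \oo -->
    atan (complex.Im z / (1 + complex.Re z)).
Proof.
move=> z1; apply/cvgrPdist_lt => e e0.
have r0 := normc_ge0 z; set rho := normc z in z1 r0.
have d0 : 0 < 1 - rho by rewrite subr_gt0.
have : (GRing.exp rho : nat -> R) @ \oo --> (0 : R).
  by apply: cvg_expr; rewrite ger0_norm.
(* The tolerance e (1 - rho) absorbs the denominator of the error bound rho^N / (1 - rho). *)
move=> /cvgrPdist_lt/(_ _ (mulr_gt0 e0 d0)); apply: filterS => N.
rewrite sub0r normrN ger0_norm ?exprn_ge0// distrC => h.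
rewrite -ltr_pdivrMr// in h; apply: le_lt_trans h.
by move: z1; rewrite /rho; case: z {r0 d0 rho} => a b z1; exact: Im_ln1p_partial_atan.
Qed.

Lemma contracts_normc_entry (R : realType) (rho : R) m n (M : 'M[R[i]]_(m, n)) i j :
  0 <= rho -> contracts (rho%:C ^+ 2) M -> normc (M i j) <= rho.
Proof.
move=> r0 /(contracts_entry i j).
rewrite ler_sqr ?nnegrE ?normr_ge0 ?ler0c// normc_def lecR.
by case: (M i j).
Qed.

Lemma normc_ln_coef_le1 (R : rcfType) k :
  normc ((-1) ^+ k / k.+1%:R : R[i]) <= 1.
Proof.
have -> : (-1) ^+ k / k.+1%:R = ((-1) ^+ k / k.+1%:R : R)%:C :> R[i].
  by rewrite fmorph_div rmorphXn rmorphN1 rmorph_nat.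
rewrite normc_real normrM normrX normrN1 expr1n mul1r ger0_norm ?invr_ge0//.
by rewrite invf_le1 ?ltr0n// ler1n.
Qed.

(** One factor rho is given away so that the terms of the logarithm series, indexed from 0, are
    dominated by the geometric series with the same index. *)
Lemma contracts_normc_entryX (R : realType) (rho : R) n (Z : 'M[R[i]]_n) k i j :
  0 <= rho < 1 -> contracts (rho%:C ^+ 2) Z ->
  normc ((Z ^+ k.+1) i j) <= rho ^+ k.
Proof.
move=> /andP[r0 r1] hZ; apply: le_trans (_ : rho ^+ k.+1 <= _); last first.
  by rewrite exprS ler_piMl ?exprn_ge0// ltW.
apply: contracts_normc_entry; first exact: exprn_ge0.
rewrite rmorphXn /= exprAC; apply: contractsX; last exact: hZ.
by rewrite exprn_ge0// ler0c.
Qed.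

Lemma expi_atan_1p (R : realType) (z : R[i]) : normc z < 1 ->
  expi (atan (complex.Im z / (1 + complex.Re z))) * `|1 + z| = 1 + z.
Proof.
case: z => a b ab1; have a1 : 0 < 1 + a.
  rewrite -ltrBlDl sub0r ltrNl; apply: le_lt_trans (ler_norm _) _.
  apply: le_lt_trans ab1; rewrite normrN.
  exact: (normc_ge_Re (a +i* b)).
have -> : 1 + (a +i* b) = (1 + a) +i* b.
  by apply/eqP; rewrite eq_complex /= add0r !eqxx.
by rewrite normc_def -[X in X%:C]/(normc ((1 + a) +i* b)) expi_atan.
Qed.

(** The trace of a partial sum is the sum of the scalar partial sums at the eigenvalues of Z. In the
    limit Im tr ln (1 + Z) is the sum of the arguments of the 1 + T_jj, and the product of these
    numbers is det (1 + Z). *)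
Lemma expi_Im_tr_ln (R : realType) n (Z : 'M[R[i]]_n) (rho : R) :
  0 <= rho < 1 -> contracts (rho%:C ^+ 2) Z ->
  expi (complex.Im (\tr (ln_mx (1%:M + Z)))) * `|\det (1%:M + Z)|
    = \det (1%:M + Z).
Proof.
move=> r01 hZ; have /andP[r0 r1] := r01.
have [T [eigT trT detT]] := trigonalization Z.
have T1 j : normc (T j j) < 1.
  apply: le_lt_trans r1; have := contracts_eigenvalue hZ (eigT j).
  rewrite ler_sqr ?nnegrE ?normr_ge0 ?ler0c// normc_def lecR.
  by case: (T j j).
pose u k : 'M[R[i] : numFieldType]_n := ((-1) ^+ k / k.+1%:R) *: Z ^+ k.+1.
have eln : ln_mx (1%:M + Z) = limn (series u).
  by rewrite /ln_mx addrAC subrr add0r.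
have uk k i j : normc (u k i j) <= rho ^+ k.
  rewrite mxE normcM -[leRHS]mul1r.
  exact: ler_pM (normc_ge0 _) (normc_ge0 _) (normc_ln_coef_le1 R k)
    (contracts_normc_entryX _ _ _ r01 hZ).
have [l hl] := choice (fun p : 'I_n * 'I_n =>
  @is_cvg_complex_series R (fun k => u k p.1 p.2) rho r01 (fun k => uk k p.1 p.2)).
pose S : 'M[R[i] : numFieldType]_n := \matrix_(i, j) l (i, j).
have entryE i j : (fun N => series u N i j) = series (fun k => u k i j).
  by apply/funext => N; rewrite /series /= summxE.
(* The series converges entry by entry, so [limn] takes no default value here. *)
have -> : ln_mx (1%:M + Z) = S.
  rewrite eln; apply: cvg_lim; first exact: norm_hausdorff.
  apply: cvg_mx => i j; rewrite mxE; have [h _] := hl (i, j).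
  by rewrite entryE.
(* Two limits of one sequence: the trace of the partial sums is read once from the entries and once
   from the eigenvalues. *)
have -> : complex.Im (\tr S) =
    \sum_j atan (complex.Im (T j j) / (1 + complex.Re (T j j))).
  have c1 : (fun N => \sum_j complex.Im (series (fun k => u k j j) N)) @ \oo -->
      complex.Im (\tr S).
    rewrite /mxtrace Im_sum; apply: cvg_bigsum => j.
    by rewrite mxE; have [_ h] := hl (j, j).
  have c2 := cvg_bigsum (r := index_enum 'I_n)
    (fun j => cvg_Im_ln1p_partial (T1 j)).
  apply: (cvg_unique _ c1); first exact: Rhausdorff.
  suff -> : (fun N => \sum_j complex.Im (series (fun k => u k j j) N)) =
      (fun N => \sum_j complex.Im (ln1p_partial (T j j) N)) by exact: c2.
  apply/funext => N; rewrite -!Im_sum; congr complex.Im.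
  rewrite [RHS]exchange_big /=.
  transitivity (\sum_j \sum_(k < N) u k j j).
    by apply: eq_bigr => j _; rewrite /series /= big_mkord.
  rewrite exchange_big /=; apply: eq_bigr => k _.
  by rewrite -mulr_sumr -trT /mxtrace mulr_sumr; apply: eq_bigr => j _; rewrite mxE.
rewrite detT expi_sum normr_prod -big_split /=; apply: eq_bigr => j _.
exact: expi_atan_1p.
Qed.

(** * Contractions from Gram identities *)

Section gram.
Variable C : numClosedFieldType.

Lemma dotmx_adj m n (x : 'rV[C]_m) (M : 'M[C]_(m, n)) (y : 'rV[C]_n) :
  dotmx (x *m M) y = dotmx x (y *m M ^t*).
Proof. by rewrite !dotmxE trmx_mul map_mxM /= trmxCK mulmxA. Qed.

(* Expand |x - x M M^*|^2 >= 0, using |x M M^*| <= |x M|. *)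
Lemma gram_contracts m n (M : 'M[C]_(m, n)) p (N : 'M[C]_(n, p)) :
  M ^t* *m M + N *m N ^t* = 1%:M -> contracts 1 M.
Proof.
move=> h x; set y := x *m M.
have e1 : dotmx x (y *m M ^t*) = dotmx y y by rewrite -dotmx_adj.
have e2 : dotmx (y *m M ^t*) (y *m M ^t*) = dotmx y y - dotmx (y *m N) (y *m N).
  rewrite !dotmxE !trmx_mul !map_mxM /= trmxCK -!mulmxA.
  rewrite [M ^t* *m (M *m _)]mulmxA.
  have -> : M ^t* *m M = 1%:M - N *m N ^t* by rewrite -h addrK.
  rewrite mulmxBl mul1mx !mulmxBr mxE [X in _ + X]mxE.
  by rewrite !mulmxA.
have := dnorm_ge0 (@dotmx C m) (x - y *m M ^t*).
rewrite dnormB /= e1 e2 mul1r geC0_conj ?dnorm_ge0// => h1.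
have h2 := dnorm_ge0 (@dotmx C p) (y *m N).
rewrite -subr_ge0; apply: le_trans h1 _; rewrite -subr_ge0.
by rewrite (_ : _ - _ = dotmx (y *m N) (y *m N))//; ring.
Qed.

(** The constant is the squared Frobenius norm: apply Cauchy-Schwarz to x and each column of M, and
    add up. *)
Lemma bounded_mx m n (M : 'M[C]_(m, n)) : contracts (\tr (M ^t* *m M)) M.
Proof.
move=> x; rewrite {1}dotmx_sum_norm /mxtrace mulr_suml; apply: ler_sum => j _.
have -> : (x *m M) 0 j = dotmx x ((col j M) ^t*).
  by rewrite dotmxE trmxCK !mxE; apply: eq_bigr => k _; rewrite mxE.
have -> : (M ^t* *m M) j j = dotmx ((col j M) ^t*) ((col j M) ^t*).
  by rewrite dotmxE trmxCK !mxE; apply: eq_bigr => k _; rewrite !mxE.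
by rewrite mulrC; exact: (CauchySchwarz (@dotmx C m) x _).1.
Qed.

(** If x P = 0, evaluating the identity at x gives - |x S|^2 = |x|^2, hence x = 0. *)
Lemma gram_unitmx n p (P : 'M[C]_n) (S : 'M[C]_(n, p)) :
  P *m P ^t* - S *m S ^t* = 1%:M -> P \in unitmx.
Proof.
move=> h; rewrite -row_free_unit -kermx_eq0; apply/eqP/row_matrixP => i.
rewrite row0; set x := row i _; have xP : x *m P = 0.
  by rewrite /x -row_mul mulmx_ker row0.
have : 0 <= dotmx (x *m S) (x *m S) := dnorm_ge0 (@dotmx C p) _.
have -> : dotmx (x *m S) (x *m S) = - dotmx x x.
  have : x *m (P *m P ^t* - S *m S ^t*) *m x ^t* = x *m x ^t* by rewrite h mulmx1.
  rewrite mulmxBr mulmxBl mulmxA xP !mul0mx add0r => e.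
  have NN (A : 'M[C]_1) : - (- A) 0 0 = A 0 0 by rewrite mxE opprK.
  by rewrite dotmxE [in RHS]dotmxE -e NN trmx_mul map_mxM !mulmxA.
by rewrite oppr_ge0 => h0; apply/eqP; rewrite -(@dnorm_eq0 _ _ (@dotmx C n)) eq_le h0 dnorm_ge0.
Qed.
End gram.

(** Put y = x P^-1. The identity gives |y S|^2 = |x|^2 - |y|^2, and |x|^2 = |y P|^2 <= b |y|^2 keeps
    |y|^2 at least |x|^2 / (b + 1). *)
Lemma strict_contraction (R : realType) n p (P : 'M[R[i]]_n) (S : 'M[R[i]]_(n, p)) :
  P *m P ^t* - S *m S ^t* = 1%:M ->
  exists2 rho : R, 0 <= rho < 1 & contracts (rho%:C ^+ 2) (invmx P *m S).
Proof.
move=> h; have Pu := gram_unitmx h.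
set B := \tr (P ^t* *m P).
have B0 : 0 <= B.
  rewrite /B /mxtrace sumr_ge0// => i _; rewrite mxE sumr_ge0// => k _.
  by rewrite !mxE mulrC mul_conjC_ge0.
have [b eB] : exists b : R, B = b%:C by exact/complex_realP/ger0_real.
have b0 : 0 <= b by rewrite -ler0c -eB.
have b1 : 0 < b + 1 by rewrite ltr_wpDl.
have c0 : 0 <= 1 - (b + 1)^-1 by rewrite subr_ge0 invf_le1// lerDr.
(* With [b + 1] instead of [b], the radicand lies in [0, 1) as soon as [0 <= b]. *)
exists (Num.sqrt (1 - (b + 1)^-1)).
  rewrite sqrtr_ge0 /= -[ltRHS]sqrtr1 ltr_sqrt// ltrBlDr ltrDl invr_gt0//.
move=> x; rewrite -rmorphXn sqr_sqrtr// mulmxA; set y := x *m invmx P.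
have ex : x = y *m P by rewrite mulmxKV.
have e : dotmx (y *m S) (y *m S) = dotmx x x - dotmx y y.
  have : y *m (P *m P ^t* - S *m S ^t*) *m y ^t* = y *m y ^t* by rewrite h mulmx1.
  rewrite mulmxBr mulmxBl => e.
  rewrite {1 2}ex !dotmxE -e !trmx_mul !map_mxM !mulmxA /=.
  have sub (A D : 'M[R[i]]_1) : D 0 0 = A 0 0 - (A - D) 0 0.
    by rewrite !mxE opprB addrC subrK.
  exact: sub.
rewrite e rmorphB rmorph1 mulrBl mul1r lerD2l lerN2.
rewrite fmorphV ler_pdivrMl; last by rewrite (ltcR 0).
have := bounded_mx P y; rewrite -/B eB -ex => h1; apply: le_trans h1 _.
by rewrite ler_wpM2r ?dnorm_ge0// lecR lerDl.
Qed.

(** * The Cayley transform of the symplectic group *)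

(** The block columns (1, a) and (a, 1) are eigenvectors of K for a and -a; with a = i this says
    that J diagonalises K. *)
Lemma block_cayley_sign (F : comNzRingType) n (a : F) : a * a = -1 ->
  block_mx 1%:M a%:M a%:M 1%:M *m block_mx 1%:M 0 0 (- 1%:M) =
  - a *: (block_mx 0 1%:M (- 1%:M) 0 *m block_mx 1%:M a%:M a%:M 1%:M)
  :> 'M[F]_(n + n).
Proof.
move=> aa; rewrite !mulmx_block.
rewrite !(mulmxN, mulNmx, mul1mx, mulmx1, mul0mx, mulmx0, addr0, add0r).
rewrite scale_block_mx !scalerN !scaleNr !opprK !scale_scalar_mx aa.
by rewrite mulr1 raddfN opprK.
Qed.

Lemma conj_mulmx (F : comUnitRingType) n (P A B : 'M[F]_n) : P \in unitmx ->
  invmx P *m (A *m B) *m P = invmx P *m A *m P *m (invmx P *m B *m P).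
Proof. by move=> Pu; rewrite !mulmxA mulmxK. Qed.

Lemma det_inv_mul_inv (F : comUnitRingType) n (A B D : 'M[F]_n) :
  \det (invmx A *m B *m invmx D) = (\det A)^-1 * \det B / \det D.
Proof. by rewrite !det_mulmx !det_inv. Qed.

(** Absolute values are multiplicative, so solving the hypothesis for x gives the quotient of the
    phases. *)
Lemma phase_div (F : numFieldType) (x a b c : F) : a != 0 -> b != 0 -> c != 0 ->
  x * `|a^-1 * c / b| = a^-1 * c / b ->
  c / `|c| = x * ((a / `|a|) * (b / `|b|)).
Proof.
rewrite !normrM !normfV => a0 b0 c0 e.
have -> : x = a^-1 * c / b * (`|a| * `|b| / `|c|).
  by rewrite -e; field; rewrite !normr_eq0 a0 b0 c0.
by field; rewrite !normr_eq0 a0 b0 c0.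
Qed.

Lemma scalemxAlr (F : comNzRingType) n (a : F) (A B D : 'M[F]_n) :
  A *m (a *: B) *m D = a *: (A *m B *m D).
Proof. by rewrite -scalemxAr -scalemxAl. Qed.

Section cayley.
Variables (R : realType) (n : nat).
Implicit Types g : 'M[R]_(n + n).
Local Notation J := (Jmx R n).
Local Notation K := (Kmx R n).

(** The Hermitian form of signature (n, n): conjugation by J carries the real symplectic group into
    U(n, n). *)
Definition signmx : 'M[R[i]]_(n + n) := block_mx 1%:M 0 0 (- 1%:M).

Definition cayley g : 'M[R[i]]_(n + n) :=
  invmx J *m map_mx (real_complex R) g *m J.

Lemma conj_i : Num.conj ('i : R[i]) = - 'i.
Proof. by apply/eqP; rewrite eq_complex /= oppr0 !eqxx. Qed.

Lemma map_mx_conj_real m p (A : 'M[R]_(m, p)) :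
  map_mx (real_complex R) A ^t* = map_mx (real_complex R) A^T.
Proof. by apply/matrixP => i j; rewrite !mxE; exact: conjc_real. Qed.

Lemma Jmx_adj : J ^t* = ((Num.sqrt (2 : R))^-1)%:C *:
  block_mx 1%:M (- 'i%:M) (- 'i%:M) 1%:M.
Proof.
rewrite /Jmx linearZ /= map_mxZ /= tr_block_mx map_block_mx !tr_scalar_mx.
rewrite !map_scalar_mx /= rmorph1 conj_i; congr (_ *: _); first exact: conjc_real.
by rewrite raddfN.
Qed.

Lemma Jmx_unitary : J \is unitarymx.
Proof.
apply/unitarymxP; rewrite Jmx_adj /Jmx -scalemxAl -scalemxAr scalerA.
rewrite mulmx_block !(mulmxN, mulNmx, mul1mx, mulmx1) -scalar_mxM.
have -> : 'i * 'i = -1 :> R[i] by rewrite -expr2 sqr_i.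
rewrite raddfN /= opprK addNr subrr [RHS]scalar_mx_block.
rewrite scale_block_mx !scaler0 -mulr2n.
have -> : ((Num.sqrt (2 : R))^-1)%:C * ((Num.sqrt (2 : R))^-1)%:C = (2^-1)%:C.
  by rewrite -rmorphM /= -invfM -expr2 sqr_sqrtr.
have half_double (A : 'M[R[i]]_n) : (2^-1 : R)%:C *: (A *+ 2) = A.
  rewrite -scalerMnr scalerMnl -rmorphMn /= -(mulr_natr (2^-1) 2).
  by rewrite mulVf ?pnatr_eq0// rmorph1 scale1r.
by rewrite half_double.
Qed.

Lemma Jmx_unit : J \in unitmx.
Proof. exact: unitarymx_unit Jmx_unitary. Qed.

Lemma Jmx_sign : J *m signmx = - 'i *: (map_mx (real_complex R) K *m J).
Proof.
rewrite /Jmx /signmx /Kmx map_block_mx raddf0 map_scalar_mx raddfN /=.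
rewrite map_scalar_mx rmorph1 -scalemxAl -scalemxAr !scalerA mulrC -scalerA.
by rewrite block_cayley_sign// -expr2 sqr_i.
Qed.

Lemma cayleyM g h : cayley (g *m h) = cayley g *m cayley h.
Proof. by rewrite /cayley map_mxM; exact: conj_mulmx Jmx_unit. Qed.

Lemma cayley_adj g : cayley g ^t* = cayley g^T.
Proof.
rewrite /cayley !trmx_mul !map_mxM /= map_mx_conj_real !mulmxA.
by rewrite (invmx_unitary Jmx_unitary) trmxCK.
Qed.

Lemma cayley_Kmx : signmx = - 'i *: cayley K.
Proof.
have := congr1 (mulmx (invmx J)) Jmx_sign.
by rewrite mulKmx ?Jmx_unit// => ->; rewrite -scalemxAr /cayley mulmxA.
Qed.

Lemma Kmx_sqr : K *m K = - 1%:M.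
Proof.
rewrite /Kmx mulmx_block !(mulmxN, mulNmx, mul1mx, mulmx1, mul0mx, mulmx0, addr0, add0r).
by rewrite [in RHS]scalar_mx_block opp_block_mx !oppr0 addr0.
Qed.

Lemma SpR_tr g : SpR g -> g *m K *m g^T = K.
Proof.
rewrite /SpR /= => h.
have e : (- (g^T *m K)) *m (g *m K) = 1%:M.
  by rewrite mulNmx mulmxA h Kmx_sqr opprK.
have := mulmx1C e; rewrite mulmxN => e2.
have : g *m K *m g^T *m K *m K = - K by rewrite -[in RHS](mul1mx K) -e2 mulNmx opprK !mulmxA.
by rewrite -mulmxA Kmx_sqr mulmxN mulmx1 => /oppr_inj.
Qed.

Lemma SpRM g h : SpR g -> SpR h -> SpR (g *m h).
Proof.
rewrite /SpR /= => hg hh; rewrite trmx_mul !mulmxA.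
by rewrite -[_ *m g^T *m _]mulmxA -[_ *m _ *m g]mulmxA hg.
Qed.

Lemma cayley_sign g : g *m K *m g^T = K ->
  cayley g *m signmx *m cayley g ^t* = signmx.
Proof.
move=> e; rewrite cayley_Kmx cayley_adj scalemxAlr -!cayleyM.
by rewrite e.
Qed.

Lemma cayley_sign_adj g : SpR g ->
  cayley g ^t* *m signmx *m cayley g = signmx.
Proof.
move=> e; rewrite cayley_Kmx cayley_adj scalemxAlr -!cayleyM.
by rewrite e.
Qed.

Definition Psi g : 'M[R[i]]_n := ursubmx (cayley g).
(** Read off as a block rather than as the conjugate of [Psi]; it is controlled by
    [Phi_gram_adj]. *)
Definition Psi_bar g : 'M[R[i]]_n := dlsubmx (cayley g).

Lemma cayley_block g :
  cayley g = block_mx (Phi g) (Psi g) (Psi_bar g) (drsubmx (cayley g)).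
Proof. by rewrite -[LHS]submxK. Qed.

Lemma Phi_gram g : SpR g ->
  Phi g *m Phi g ^t* - Psi g *m Psi g ^t* = 1%:M.
Proof.
move=> /SpR_tr/cayley_sign/(congr1 ulsubmx); rewrite cayley_block.
rewrite /signmx tr_block_mx map_block_mx !mulmx_block !block_mxKul.
by rewrite !mulmx0 !mulmx1 mulmxN mulmx1 addr0 add0r mulNmx.
Qed.

Lemma Phi_gram_adj g : SpR g ->
  Phi g ^t* *m Phi g - Psi_bar g ^t* *m Psi_bar g = 1%:M.
Proof.
move=> /cayley_sign_adj/(congr1 ulsubmx); rewrite cayley_block.
rewrite /signmx tr_block_mx map_block_mx !mulmx_block !block_mxKul.
by rewrite !mulmx0 !mulmx1 mulmxN mulmx1 addr0 add0r mulNmx.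
Qed.

Lemma PhiM g h : Phi (g *m h) = Phi g *m Phi h + Psi g *m Psi_bar h.
Proof.
have := congr1 ulsubmx (cayleyM g h).
by rewrite [cayley g]cayley_block [cayley h]cayley_block mulmx_block block_mxKul.
Qed.

Lemma Phi_unit g : SpR g -> Phi g \in unitmx.
Proof. by move/Phi_gram; exact: gram_unitmx. Qed.

(** This splits Z into a factor depending on g alone and a factor depending on h alone, which are
    estimated separately. *)
Lemma Phi_bracket g h : SpR g -> SpR h ->
  invmx (Phi g) *m Phi (g *m h) *m invmx (Phi h) =
  1%:M + (invmx (Phi g) *m Psi g) *m (Psi_bar h *m invmx (Phi h)).
Proof.
move=> hg hh; rewrite PhiM mulmxDr mulmxDl mulKmx ?Phi_unit// mulmxV ?Phi_unit//.
by rewrite !mulmxA.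
Qed.

Lemma Psi_bar_contracts g : SpR g -> contracts 1 (Psi_bar g *m invmx (Phi g)).
Proof.
move=> hg; have Pu := Phi_unit hg.
(* Multiplying [Phi_gram_adj] by Phi^-1 on the right and its adjoint on the left gives the Gram
   identity, with this matrix as N. *)
apply: (@gram_contracts _ _ _ _ _ (invmx (Phi g) ^t*)).
rewrite trmxCK trmx_mul map_mxM /= mulmxA -[X in X *m _ + _]mulmxA.
have -> : Psi_bar g ^t* *m Psi_bar g = Phi g ^t* *m Phi g - 1%:M.
  by rewrite -(Phi_gram_adj hg) opprB addrC subrK.
rewrite mulmxBr mulmx1 mulmxBl subrK mulmxA mulmxK// -map_mxM -trmx_mul.
by rewrite mulmxV// trmx1 map_mx1.
Qed.

Definition phase g : R[i] := \det (Phi g) / `|\det (Phi g)|.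

Lemma det_Phi_neq0 g : SpR g -> \det (Phi g) != 0.
Proof. by move/Phi_unit; rewrite unitmxE unitfE. Qed.

Lemma phase_cocycle g h : SpR g -> SpR h ->
  phase (g *m h) = expi (berezin g h) * (phase g * phase h).
Proof.
move=> hg hh; have [rho r01 hr] := strict_contraction (Phi_gram hg).
(* Strictness comes from the factor of g; the factor of h contributes the constant 1. *)
have hZ := contractsM ler01 hr (Psi_bar_contracts hh).
rewrite mulr1 in hZ.
have : expi (berezin g h) *
    `|\det (invmx (Phi g) *m Phi (g *m h) *m invmx (Phi h))| =
    \det (invmx (Phi g) *m Phi (g *m h) *m invmx (Phi h)).
  by rewrite /berezin (Phi_bracket hg hh); exact: (expi_Im_tr_ln r01 hZ).
rewrite det_inv_mul_inv.
exact: phase_div (det_Phi_neq0 hg) (det_Phi_neq0 hh) (det_Phi_neq0 (SpRM hg hh)).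
Qed.
End cayley.

(** * Integral symplectic matrices *)

Section generators.
Variables (R : realType) (n : nat).
Implicit Types A B S T : 'M[R]_n.
Local Notation K := (Kmx R n).

Definition upper_unip S : 'M[R]_(n + n) := block_mx 1%:M S 0 1%:M.
Definition lower_unip S : 'M[R]_(n + n) := block_mx 1%:M 0 S 1%:M.
(** Used with [A^T *m B = 1%:M]; carrying both blocks avoids inverses and makes integrality a
    condition on entries. *)
Definition levi A B : 'M[R]_(n + n) := block_mx A 0 0 B.

Ltac simp_block := rewrite !mulmx_block ?(mulmxN, mulNmx, mul1mx, mulmx1,
  mul0mx, mulmx0, addr0, add0r, oppr0, opprK, subr0).

Lemma SpR_upper_unip S : S^T = S -> SpR (upper_unip S).
Proof.
move=> sS; rewrite /SpR /= /upper_unip /Kmx tr_block_mx !trmx1 trmx0 sS.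
by simp_block; rewrite ?subrr ?addNr.
Qed.

Lemma SpR_lower_unip S : S^T = S -> SpR (lower_unip S).
Proof.
move=> sS; rewrite /SpR /= /lower_unip /Kmx tr_block_mx !trmx1 trmx0 sS.
by simp_block; rewrite ?subrr ?addNr.
Qed.

Lemma SpR_levi A B : A^T *m B = 1%:M -> SpR (levi A B).
Proof.
move=> AB; rewrite /SpR /= /levi /Kmx tr_block_mx !trmx0.
have BA : B^T *m A = 1%:M by rewrite -[LHS]trmxK trmx_mul trmxK AB trmx1.
by simp_block; rewrite AB BA.
Qed.

Lemma SpR_Kmx : SpR K.
Proof.
rewrite /SpR /= /Kmx tr_block_mx !trmx0 linearN /= !trmx1.
by simp_block.
Qed.

Lemma SpR1 : SpR (1%:M : 'M[R]_(n + n)).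
Proof. by rewrite /SpR /= trmx1 mul1mx mulmx1. Qed.

Lemma upper_unipD S T : upper_unip S *m upper_unip T = upper_unip (S + T).
Proof. by rewrite /upper_unip; simp_block; rewrite addrC. Qed.

Lemma levi_upper_unip A B S : A^T *m B = 1%:M ->
  levi A B *m upper_unip S = upper_unip (A *m S *m A^T) *m levi A B.
Proof.
by move=> AB; rewrite /levi /upper_unip; simp_block; rewrite -[_ *m B]mulmxA AB mulmx1.
Qed.

Lemma Kmx_upper_unip S : K *m upper_unip S = lower_unip (- S) *m K.
Proof. by rewrite /Kmx /upper_unip /lower_unip; simp_block. Qed.

(** For P idempotent, W has blocks 1 - P, P, -P, 1 - P: a quarter turn on the part cut out by P and
    the identity on the part cut out by 1 - P. *)
Lemma unip_reflection P : P *m P = P ->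
  let W := upper_unip P *m lower_unip (- P) *m upper_unip P in
  W *m W = levi (1%:M - 2 *: P) (1%:M - 2 *: P).
Proof.
move=> PP; have -> : upper_unip P *m lower_unip (- P) *m upper_unip P =
    block_mx (1%:M - P) P (- P) (1%:M - P).
  rewrite /upper_unip /lower_unip; simp_block.
  by rewrite PP mulmxBl mul1mx PP subrr add0r addrC.
have QQ : (1%:M - P) *m (1%:M - P) = 1%:M - P.
  by rewrite mulmxBl mul1mx mulmxBr mulmx1 PP subrr subr0.
rewrite /levi; simp_block; rewrite QQ PP.
have QP : (1%:M - P) *m P = 0 by rewrite mulmxBl mul1mx PP subrr.
have PQ : P *m (1%:M - P) = 0 by rewrite mulmxBr mulmx1 PP subrr.
by rewrite QP PQ oppr0 addr0 scaler_nat mulr2n opprD addrA [- P + 1%:M]addrC addrA.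
Qed.

Lemma block_int (A B S T : 'M[R]_n) :
  A \is a mxOver Num.int -> B \is a mxOver Num.int ->
  S \is a mxOver Num.int -> T \is a mxOver Num.int ->
  block_mx A B S T \is a mxOver Num.int.
Proof.
move=> /mxOverP hA /mxOverP hB /mxOverP hS /mxOverP hT.
apply/mxOverP => i j.
by case: (split_ordP i) => k ->; case: (split_ordP j) => l ->;
  rewrite ?block_mxEul ?block_mxEur ?block_mxEdl ?block_mxEdr.
Qed.

Lemma mxOver_int0 m p : (0 : 'M[R]_(m, p)) \is a mxOver Num.int.
Proof. exact: mxOver0 (rpred0 _). Qed.

Lemma mxOver_int1 m : (1%:M : 'M[R]_m) \is a mxOver Num.int.
Proof. exact: mxOver_scalar (rpred0 _) (rpred1 _). Qed.

Lemma mxOver_intN m p (S : 'M[R]_(m, p)) :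
  S \is a mxOver Num.int -> - S \is a mxOver Num.int.
Proof. by move=> /mxOverP h; apply/mxOverP => i j; rewrite mxE rpredN. Qed.

Lemma SpZE (g : 'M[R]_(n + n)) : SpR g -> g \is a mxOver Num.int -> SpZ g.
Proof. by move=> h /mxOverP. Qed.

Lemma SpZM (g h : 'M[R]_(n + n)) : SpZ g -> SpZ h -> SpZ (g *m h).
Proof.
move=> [g1 g2] [h1 h2]; apply: SpZE; first exact: SpRM.
by apply: mxOverM; apply/mxOverP.
Qed.

Lemma SpZ1 : SpZ (1%:M : 'M[R]_(n + n)).
Proof. exact: SpZE SpR1 (mxOver_int1 _). Qed.

Lemma SpZ_Kmx : SpZ K.
Proof.
apply: SpZE SpR_Kmx _; apply: block_int; try exact: mxOver_int0.
  exact: mxOver_int1.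
by apply: mxOver_intN; exact: mxOver_int1.
Qed.

Lemma SpZ_upper_unip S : S^T = S -> S \is a mxOver Num.int -> SpZ (upper_unip S).
Proof.
move=> sS iS; apply: SpZE; first exact: SpR_upper_unip.
by apply: block_int => //; solve [exact: mxOver_int0 | exact: mxOver_int1].
Qed.

Lemma SpZ_lower_unip S : S^T = S -> S \is a mxOver Num.int -> SpZ (lower_unip S).
Proof.
move=> sS iS; apply: SpZE; first exact: SpR_lower_unip.
by apply: block_int => //; solve [exact: mxOver_int0 | exact: mxOver_int1].
Qed.

Lemma SpZ_levi A B : A^T *m B = 1%:M -> A \is a mxOver Num.int ->
  B \is a mxOver Num.int -> SpZ (levi A B).
Proof.
move=> AB iA iB; apply: SpZE; first exact: SpR_levi.
by apply: block_int => //; exact: mxOver_int0.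
Qed.
End generators.

(** * Homomorphisms from the integral symplectic group to a field *)

Section character_vanishing.
Variables (R : realType) (n : nat) (F : fieldType).
Variable chi : 'M[R]_(n + n) -> F.
Hypothesis chi_neq0 : forall g, SpZ g -> chi g != 0.
Hypothesis chiM : forall g h, SpZ g -> SpZ h -> chi (g *m h) = chi g * chi h.

(** The two matrices are conjugate by K, and the value at K cancels in a commutative field. *)
Lemma chi_lower_unip (S : 'M[R]_n) : S^T = S -> S \is a mxOver Num.int ->
  chi (lower_unip (- S)) = chi (upper_unip S).
Proof.
move=> sS iS; have kS := SpZ_upper_unip sS iS.
have lS : SpZ (lower_unip (- S)).
  by apply: SpZ_lower_unip; [rewrite linearN /= sS|exact: mxOver_intN].
have e := congr1 chi (Kmx_upper_unip S).
rewrite !chiM // in e; try exact: SpZ_Kmx.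
by apply: (mulIf (chi_neq0 (SpZ_Kmx R n))); rewrite -e mulrC.
Qed.

Lemma chi_levi_upper_unip (A B S : 'M[R]_n) : A^T *m B = 1%:M ->
  A \is a mxOver Num.int -> B \is a mxOver Num.int ->
  S^T = S -> S \is a mxOver Num.int ->
  chi (upper_unip (A *m S *m A^T)) = chi (upper_unip S).
Proof.
move=> AB iA iB sS iS; have hl := SpZ_levi AB iA iB.
have hS := SpZ_upper_unip sS iS.
have sS' : (A *m S *m A^T)^T = A *m S *m A^T.
  by rewrite !trmx_mul trmxK sS mulmxA.
have iS' : A *m S *m A^T \is a mxOver Num.int.
  apply: mxOverM; first exact: mxOverM.
  by apply/mxOverP => i j; rewrite mxE; exact: (mxOverP iA).
have e := congr1 chi (levi_upper_unip S AB).
rewrite (chiM hl hS) (chiM (SpZ_upper_unip sS' iS') hl) in e.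
by apply: (mulIf (chi_neq0 hl)); rewrite -e mulrC.
Qed.

Section two_indices.
Variables (i0 i1 : 'I_n).
Hypothesis i01 : i0 != i1.
Local Notation d i j := (delta_mx i j : 'M[R]_n).

Lemma int_delta i j : d i j \is a mxOver Num.int.
Proof. by apply/mxOverP => k l; rewrite mxE rpred_nat. Qed.

(* Conjugation by the transvection [1 + a E_10] sends [e_0 e_0^T] to
   [(e_0 + a e_1) (e_0 + a e_1)^T]. *)
Lemma chi_transvection (a : R) : a \is a Num.int ->
  chi (upper_unip (d i0 i0 + a *: (d i0 i1 + d i1 i0) + a ^+ 2 *: d i1 i1))
    = chi (upper_unip (d i0 i0)).
Proof.
move=> ia; set A : 'M[R]_n := 1%:M + a *: d i1 i0.
have AT : A^T = 1%:M + a *: d i0 i1.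
  by rewrite /A linearD linearZ /= trmx1 trmx_delta.
have i10 : (i1 == i0) = false by rewrite eq_sym; exact: negbTE.
have -> : d i0 i0 + a *: (d i0 i1 + d i1 i0) + a ^+ 2 *: d i1 i1 =
    A *m d i0 i0 *m A^T.
  rewrite AT /A mulmxDl mul1mx -scalemxAl mul_delta_mx mulmxDl !mulmxDr !mulmx1.
  rewrite -!scalemxAr -scalemxAl !mul_delta_mx scalerA -expr2 scalerDr.
  by rewrite !addrA.
have iE i j : a *: d i j \is a mxOver Num.int.
  by apply/mxOverP => k l; rewrite mxE rpredM//; exact: (mxOverP (int_delta i j)).
have iD (S T : 'M[R]_n) : S \is a mxOver Num.int -> T \is a mxOver Num.int ->
    S + T \is a mxOver Num.int.
  move=> /mxOverP hS /mxOverP hT; apply/mxOverP => k l.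
  by rewrite mxE rpredD.
(* The inverse transpose of A, because E_01 squares to zero when the indices differ. *)
apply: (@chi_levi_upper_unip _ (1%:M - a *: d i0 i1)).
- rewrite AT mulmxBr mulmx1 mulmxDl mul1mx -scalemxAl -scalemxAr.
  by rewrite mul_delta_mx_0 ?i10// !scaler0 addr0 addrK.
- exact: iD (mxOver_int1 _ _) (iE _ _).
- exact: iD (mxOver_int1 _ _) (mxOver_intN (iE _ _)).
- exact: trmx_delta.
- exact: int_delta.
Qed.

Lemma chi_upper_unip_delta_sqr : chi (upper_unip (d i1 i1)) ^+ 2 = 1.
Proof.
have sym i : (d i i)^T = d i i by exact: trmx_delta.
have u i : SpZ (upper_unip (d i i)).
  exact: SpZ_upper_unip (sym i) (int_delta i i).
have uD (g h : 'M[R]_n) : SpZ (upper_unip g) -> SpZ (upper_unip h) ->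
    chi (upper_unip (g + h)) = chi (upper_unip g) * chi (upper_unip h).
  by move=> hg hh; rewrite -upper_unipD chiM.
have uuD (g h : 'M[R]_n) : SpZ (upper_unip g) -> SpZ (upper_unip h) ->
    SpZ (upper_unip (g + h)).
  by move=> hg hh; rewrite -upper_unipD; exact: SpZM.
set D := d i0 i0; set D1 := d i1 i1; set X := d i0 i1 + d i1 i0.
have symX : X^T = X by rewrite /X linearD /= !trmx_delta addrC.
have tX (a : R) : a \is a Num.int -> a ^+ 2 = 1 ->
    chi (upper_unip (D + a *: X + D1)) = chi (upper_unip D)
    /\ SpZ (upper_unip (D + a *: X + D1)).
  move=> ia a2; have := chi_transvection ia; rewrite a2 scale1r => ->; split=> //.
  apply: SpZ_upper_unip.
    by rewrite [LHS]linearD /= [(D + _)^T]linearD /= linearZ /= symX /D /D1 !sym.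
  apply/mxOverP => k l; rewrite !mxE.
  by rewrite !rpredD ?rpredM ?rpredD ?rpred_nat.
have [e1 s1] := tX 1 (rpred1 _) (expr1n _ _).
have [e2 s2] := tX (-1) (rpredN1 _) (etrans (sqrrN _) (expr1n _ _)).
have e := uD _ _ s1 s2; rewrite e1 e2 in e.
(* The cross terms for a = 1 and a = -1 cancel. *)
have E : D + 1 *: X + D1 + (D + -1 *: X + D1) = (D + D1) + (D + D1).
  by rewrite scale1r scaleN1r [D + X + _]addrAC [D - X + _]addrAC addrACA subrr addr0.
have [uD0 uD1] := (u i0, u i1).
rewrite E (uD _ _ (uuD _ _ uD0 uD1) (uuD _ _ uD0 uD1)) (uD _ _ uD0 uD1) in e.
have x0 := chi_neq0 uD0; rewrite -/D in x0.
(* Both sides contain the square of the value at D, which is cancelled. *)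
apply: (mulfI (mulf_neq0 x0 x0)); rewrite mulr1 -[RHS]e; ring.
Qed.

Lemma chi_reflection :
  chi (levi (1%:M - 2 *: d i1 i1) (1%:M - 2 *: d i1 i1)) = 1.
Proof.
have sym : (d i1 i1)^T = d i1 i1 by exact: trmx_delta.
have int1 := int_delta i1 i1.
have hu := SpZ_upper_unip sym int1.
have hl : SpZ (lower_unip (- d i1 i1)).
  by apply: SpZ_lower_unip; [rewrite linearN /= sym|exact: mxOver_intN].
rewrite -unip_reflection ?mul_delta_mx//=.
have hul := SpZM hu hl; have hulu := SpZM hul hu.
rewrite (chiM hulu hulu) (chiM hul hu) (chiM hu hl) chi_lower_unip//.
have := chi_upper_unip_delta_sqr; set t := chi _ => t2.
have -> : t * t * t * (t * t * t) = (t ^+ 2) ^+ 3 by ring.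
by rewrite t2 expr1n.
Qed.
End two_indices.
End character_vanishing.

(** * Cocycle and phase at a reflection *)

Lemma det_reflection (F : comNzRingType) n (i : 'I_n) :
  \det (1%:M - 2 *: delta_mx i i : 'M[F]_n) = -1.
Proof.
rewrite det_trig; last first.
  apply/is_trig_mxP => k l kl; have kl' : (k == l) = false.
    by apply/eqP => e; rewrite e ltnn in kl.
  rewrite !mxE kl' (_ : _ && _ = false) ?mulr0 ?subr0//.
  by apply/andP => -[/eqP ki /eqP li]; rewrite ki li eqxx in kl'.
rewrite (bigD1 i)//= big1 => [|k ki]; rewrite !mxE !eqxx; last first.
  by rewrite (negPf ki) mulr0 subr0.
by rewrite !mulr1 -[2]/(1 + 1) opprD addrA subrr add0r.
Qed.

Lemma block_scalar_comm (F : comNzRingType) n (a : F) (Q : 'M[F]_n) :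
  block_mx Q 0 0 Q *m block_mx 1%:M a%:M a%:M 1%:M =
  block_mx 1%:M a%:M a%:M 1%:M *m block_mx Q 0 0 Q.
Proof.
rewrite !mulmx_block !(mulmx1, mul1mx, mul0mx, mulmx0, addr0, add0r).
by rewrite scalar_mxC.
Qed.

Lemma ln_mx1 (K : numFieldType) n : ln_mx (1%:M : 'M[K]_n) = 0.
Proof.
rewrite /ln_mx subrr; apply: cvg_lim; first exact: norm_hausdorff.
rewrite (_ : series _ = fun=> 0); first exact: cvg_cst.
apply/funext => N; rewrite /series /= big1// => k _.
by rewrite exprS mul0r scaler0.
Qed.

Lemma expi_neq0 (R : realType) (t : R) : expi t != 0.
Proof.
by apply/eqP => e; have := expiNK t; rewrite e mulr0 => /esym/eqP; rewrite oner_eq0.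
Qed.

Lemma phase_neq0 (R : realType) n (g : 'M[R]_(n + n)) : SpR g -> phase g != 0.
Proof.
move=> /det_Phi_neq0; rewrite /phase; move: (\det _) => a a0.
by rewrite mulf_neq0// invr_eq0 normr_eq0.
Qed.

Section levi_phase.
Variables (R : realType) (n : nat).
Local Notation J := (Jmx R n).

Lemma leviM (A B A' B' : 'M[R]_n) :
  levi A B *m levi A' B' = levi (A *m A') (B *m B').
Proof. by rewrite /levi mulmx_block !mulmx0 !mul0mx !addr0 add0r. Qed.

Lemma levi1 : levi 1%:M 1%:M = 1%:M :> 'M[R]_(n + n).
Proof. by rewrite [RHS]scalar_mx_block. Qed.

Lemma reflection_sqr (i : 'I_n) :
  let Q : 'M[R]_n := 1%:M - 2 *: delta_mx i i in Q *m Q = 1%:M.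
Proof.
rewrite /= mulmxBl mul1mx mulmxBr mulmx1 -scalemxAr -!scalemxAl mul_delta_mx.
rewrite !scaler_nat !mulr2n opprB addrA.
by set b := delta_mx i i + _; rewrite [_ + (b + b)]addrA subrK addrK.
Qed.

Lemma SpZ_levi_reflection (i : 'I_n) :
  let Q : 'M[R]_n := 1%:M - 2 *: delta_mx i i in SpZ (levi Q Q).
Proof.
move=> Q; have QT : Q^T = Q.
  by rewrite /Q linearB /= linearZ /= trmx1 trmx_delta.
have iQ : Q \is a mxOver Num.int.
  by apply/mxOverP => k l; rewrite !mxE rpredB ?rpredM ?rpred_nat.
by apply: SpZ_levi => //; rewrite QT; exact: reflection_sqr.
Qed.

(** All blocks of J are scalar, so J commutes with diag(Q, Q). *)
Lemma Phi_levi (Q : 'M[R]_n) : Phi (levi Q Q) = map_mx (real_complex R) Q.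
Proof.
have h : map_mx (real_complex R) (levi Q Q) *m J =
    J *m map_mx (real_complex R) (levi Q Q).
  rewrite /levi /Jmx map_block_mx raddf0 -scalemxAr -scalemxAl.
  by rewrite block_scalar_comm.
rewrite /Phi -mulmxA h mulKmx ?Jmx_unit//.
by rewrite /levi map_block_mx block_mxKul.
Qed.

(** The bracket is Q^-1 Q^-1 = 1, whose logarithm is 0. *)
Lemma berezin_involution (Q : 'M[R]_n) : Q *m Q = 1%:M ->
  berezin (levi Q Q) (levi Q Q) = 0.
Proof.
move=> QQ; have fQQ : map_mx (real_complex R) Q *m map_mx (real_complex R) Q = 1%:M.
  by rewrite -map_mxM QQ map_mx1.
rewrite /berezin leviM QQ !Phi_levi.
have [Qu _] := mulmx1_unit fQQ.
have iQ : invmx (map_mx (real_complex R) Q) = map_mx (real_complex R) Q.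
  by rewrite -[LHS]mulmx1 -fQQ mulKmx.
by rewrite iQ map_mx1 mulmx1 fQQ ln_mx1 mxtrace0.
Qed.

Lemma phase_levi_reflection (i : 'I_n) :
  let Q : 'M[R]_n := 1%:M - 2 *: delta_mx i i in phase (levi Q Q) = -1.
Proof.
rewrite /= /phase Phi_levi det_map_mx det_reflection rmorphN1.
by rewrite normrN1 divr1.
Qed.
End levi_phase.

Theorem theorem4p1 (R : realType) (n : nat) (hn : (2 < n)%N) :
  ~ exists gamma : 'M[R]_(n + n) -> R,
      forall g1 g2 : 'M[R]_(n + n), SpZ g1 -> SpZ g2 ->
        berezin g1 g2 = gamma g1 + gamma g2 - gamma (g1 *m g2).
Proof.
case=> gamma h; pose chi g := expi (gamma g) * phase g.
have chiM (g1 g2 : 'M[R]_(n + n)) : SpZ g1 -> SpZ g2 ->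
    chi (g1 *m g2) = chi g1 * chi g2.
  move=> h1 h2; rewrite /chi (phase_cocycle h1.1 h2.1) h// mulrA -expiD.
  by rewrite addrC subrK expiD mulrACA.
have chi_neq0 (g : 'M[R]_(n + n)) : SpZ g -> chi g != 0.
  by move=> hg; exact: mulf_neq0 (expi_neq0 _) (phase_neq0 hg.1).
pose i0 : 'I_n := Ordinal (ltn_trans (isT : 0 < 2)%N hn).
pose i1 : 'I_n := Ordinal (ltn_trans (isT : 1 < 2)%N hn).
have i01 : i0 != i1 by [].
have := chi_reflection chi_neq0 chiM i01.
set Q : 'M[R]_n := 1%:M - 2 *: delta_mx i1 i1.
have QQ : Q *m Q = 1%:M := reflection_sqr R i1.
have hQ : SpZ (levi Q Q) := SpZ_levi_reflection R i1.
have F2 : levi Q Q *m levi Q Q = 1%:M by rewrite leviM QQ levi1.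
(* The coboundary equation at (1, 1) reads c(1, 1) = gamma(1). *)
have g1 : gamma 1%:M = 0.
  have := h _ _ (SpZ1 R n) (SpZ1 R n); rewrite mulmx1 addrK => <-.
  by rewrite -levi1; apply: berezin_involution; exact: mulmx1.
(* At the pair (F, F) it reads 0 = 2 gamma(F) - gamma(1), and gamma is real. *)
have gQ : gamma (levi Q Q) = 0.
  have := h _ _ hQ hQ; rewrite F2 g1 subr0 berezin_involution//.
  by move=> e; lra.
rewrite /chi gQ expi0 mul1r phase_levi_reflection => /eqP.
by rewrite eq_sym -addr_eq0 (_ : 1 + 1 = 2)// pnatr_eq0.
Qed.
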